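(* Let $\mathcal{H}$ be a real Hilbert space, $\theta\in(0,1]$, and $T:\mathcal{H}\to\mathcal{H}$ a $\theta$-averaged operator with $\mathrm{Fix}\,T\neq\emptyset$. Let $0<\lambda<\frac1\theta$ and let $(\alpha_k)_{k\ge0}\subseteq(0,1)$ satisfy $\lim_{k\to+\infty}\alpha_k=0$ and $\sum_{k\ge0}\alpha_k=+\infty$. For given $x_0,v\in\mathcal{H}$, let $(x_k)_{k\ge0}$ be generated by $$x_{k+1}:=\alpha_kv+(1-\alpha_k)\left((1-\lambda)x_k+\lambda T(x_k)\right)\quad\forall k\ge0 .$$ Then $(x_k)_{k\ge0}$ converges strongly to $\xi_*:=P_{\mathrm{Fix}\,T}(v)$ as $k\to+\infty$.
   Context: $T$ is $\theta$-averaged if there exists a nonexpansive operator $N:\mathcal{H}\to\mathcal{H}$ (i.e. $\|N(x)-N(y)\|\le\|x-y\|$ for all $x,y\in\mathcal{H}$) such that $T=(1-\theta)\mathrm{Id}+\theta N$, where $\mathrm{Id}$ is the identity. $\mathrm{Fix}\,T:=\{x\in\mathcal{H}:x=T(x)\}$, which is closed and convex; $P_{\mathrm{Fix}\,T}$ denotes the metric projection onto it. *)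

(* Defs.v *)
From HB Require Import structures.
From mathcomp Require Export all_boot all_order all_algebra.
From mathcomp Require Export sesquilinear.
From mathcomp Require Export all_classical all_reals all_analysis.
Export Order.TTheory GRing.Theory Num.Theory.
Export numFieldNormedType.Exports.

Set Implicit Arguments.
Unset Strict Implicit.
Unset Printing Implicit Defensive.

Local Open Scope classical_set_scope.
Local Open Scope ring_scope.

HB.mixin Record isHilbert (R : realType) V of CompleteNormedModule R V := {
  inner : {dot V for @idfun R};
  inner_norm : forall x : V, inner x x = `|x| ^+ 2
}.

#[short(type="hilbertType")]
HB.structure Definition Hilbert (R : realType) :=
  {V of isHilbert R V & CompleteNormedModule R V}.

Section Operators.
Context {R : realType} {H : hilbertType R}.

Definition nonexpansive (N : H -> H) : Prop :=
  forall x y : H, `|N x - N y| <= `|x - y|.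

Definition averaged (theta : R) (T : H -> H) : Prop :=
  exists2 N : H -> H, nonexpansive N &
    forall x : H, T x = (1 - theta) *: x + theta *: N x.

Definition Fix (T : H -> H) : set H := [set x | x = T x].

(* Nearest points are unique in a convex set and exist in a nonempty closed
   convex one; the value [v] returned when there is none is a junk default. *)
Definition metric_proj (C : set H) (v : H) : H :=
  xget v [set p | C p /\ forall y, C y -> `|v - p| <= `|v - y|].

End Operators.

(* Main.v *)
Require Import Defs.
From mathcomp Require Import lra.

Set Implicit Arguments.
Unset Strict Implicit.
Unset Printing Implicit Defensive.

Local Open Scope classical_set_scope.
Local Open Scope ring_scope.

(** Write T = (1 - theta) Id + theta N with N nonexpansive.  Then Fix T = Fix N,
    and with kappa = lambda * theta in (0, 1) the iteration is the Halpern
    iteration x_{k+1} = alpha_k v + (1 - alpha_k) (x_k - kappa (x_k - N x_k))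
    of an averaged operator.  The proof uses neither weak compactness nor a
    demiclosedness principle.

    The limit point is produced by Browder's curve.  For r > 0, Banach's theorem
    gives z with z - N z = r (v - z) ([resolvent_exists]).  Since Id - N is
    monotone ([monotone_disp]), as r decreases to 0 the distance from v to z
    increases while staying below the distance from v to any fixed point, and
    increments of the squared distance control those of the curve ([resolvent_dist],
    [resolvent_le]); hence the points z converge ([resolvent_cvg]) to some
    p = N p.  Testing monotonicity of Id - N at z and at an arbitrary y gives
    r <v - z, y - z> <= |y - N y| |y - z|, so that <v - p, y - p> is at most e
    for every y in a given ball around p that is moved by N by a small enough
    amount ([approx_fix_variational]).  For y a fixed point this is the
    variational inequality characterizing p as the projection of v
    ([metric_proj_eq]).

    For the iteration put a_k = |x_k - p|^2 and g_k = x_k - N x_k.  Averagedness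
    ([averaged_sqr_le]) and the expansion of the square ([halpern_step_le]) give
    a_{k+1} <= (1 - alpha_k) (a_k - kappa (1 - kappa) |g_k|^2)
               + 2 alpha_k <v - p, x_{k+1} - p>.
    If |g_k| is small then x_{k+1} is close to x_k and the last inner product is
    at most e / 2 once alpha_k is small; if |g_k| is not small then the negative
    term dominates once alpha_k is small.  Either way, for every
    e > 0, a_{k+1} <= (1 - alpha_k) a_k + alpha_k e for all large k, and as the
    alpha_k sum to infinity this forces a_k to tend to 0
    ([cvg0_of_weighted_rec]). *)

(** * Real inner products and monotonicity of Id - N *)

Section InnerProduct.
Context {R : realType} {H : hilbertType R}.
Implicit Types (x y z : H) (a : R).

Lemma innerC x y : inner x y = inner y x.
Proof. by rewrite (hermC inner) expr0 mul1r. Qed.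

Lemma innerDl x y z : inner (x + y) z = inner x z + inner y z.
Proof. exact: linearDl. Qed.

Lemma innerNl x z : inner (- x) z = - inner x z.
Proof. exact: linearNl. Qed.

Lemma innerZl a x z : inner (a *: x) z = a * inner x z.
Proof. exact: linearZl_LR. Qed.

Lemma innerDr x y z : inner x (y + z) = inner x y + inner x z.
Proof. exact: linearDr. Qed.

Lemma innerNr x z : inner x (- z) = - inner x z.
Proof. exact: linearNr. Qed.

Lemma innerZr a x z : inner x (a *: z) = a * inner x z.
Proof. exact: linearZr_LR. Qed.

Definition innerE := (innerDl, innerDr, innerNl, innerNr, innerZl, innerZr).

Lemma ler_inner x y : inner x y <= `|x| * `|y|.
Proof.
have : `|x + y| ^+ 2 <= (`|x| + `|y|) ^+ 2.
  by rewrite ler_sqr ?nnegrE ?addr_ge0 // ler_normD.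
rewrite -inner_norm !innerE !inner_norm (innerC y x); lra.
Qed.

(** The displacement Id - N of a nonexpansive operator is monotone. *)
Lemma monotone_disp (N : H -> H) x y : nonexpansive N ->
  0 <= inner ((x - N x) - (y - N y)) (x - y).
Proof.
move=> neN.
have -> : (x - N x) - (y - N y) = (x - y) - (N x - N y).
  by rewrite opprD addrACA -opprD.
rewrite innerDl innerNl inner_norm subr_ge0 (le_trans (ler_inner _ _)) //.
by rewrite expr2 ler_wpM2r.
Qed.

End InnerProduct.

(** * Browder's curve and the variational inequality *)

Section Resolvent.
Context {R : realType} {H : hilbertType R}.
Implicit Types (N : H -> H) (v p : H).

Lemma resolvent_exists N v (r : R) : nonexpansive N -> 0 < r ->
  exists z, z - N z = r *: (v - z).
Proof.
move=> neN r0.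
have r10 : 0 < 1 + r by lra.
have r1N0 : 1 + r != 0 by rewrite gt_eqF.
(* z is the fixed point of the contraction z |-> (N z + r v) / (1 + r). *)
pose q := (1 + r)^-1.
have q0 : 0 <= q by rewrite invr_ge0 ltW.
pose f (z : H) : H := q *: (N z + r *: v).
have ctr : is_contraction (totalfun f).
  exists (NngNum q0); split; first by rewrite /= invf_lt1 // ltrDl.
  move=> [x y] _ /=.
  rewrite /f -scalerBr opprD addrACA subrr addr0 normrZ ger0_norm //.
  by rewrite ler_wpM2l.
have [//|z _ zE] := banach_fixed_point ctr closedT.
  by exists 0.
exists z.
have {}zE : (1 + r) *: z = N z + r *: v.
  by rewrite {1}zE /= /f scalerA mulfV // scale1r.
have -> : z - N z = (1 + r) *: z - r *: z - N z.
  by rewrite scalerDl scale1r addrK.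
by rewrite zE scalerBr addrAC [N z + _]addrC addrK.
Qed.

(** Squared increments along the curve are bounded by increments of the squared
    distance to [v]; in particular that distance increases as the parameter
    decreases. *)
Lemma resolvent_dist N v z w (r s : R) : nonexpansive N -> 0 < s < r ->
    z - N z = r *: (v - z) -> w - N w = s *: (v - w) ->
  `|w - z| ^+ 2 <= `|v - w| ^+ 2 - `|v - z| ^+ 2.
Proof.
move=> neN /andP[s0 sr] zE wE.
have := monotone_disp w z neN; rewrite wE zE.
have <- : (v - z) - (v - w) = w - z.
  by rewrite opprB addrC addrA subrK.
move: (v - w) (v - z) => a b {zE wE}.
have := sqr_ge0 `|b - a|.
rewrite -!inner_norm !innerE (innerC b a).
move: (inner a a) (inner a b) (inner b b) => aa ab bb h1 h2.
have ge0 : 0 <= s * (bb - ab *+ 2 + aa) by rewrite mulr_ge0 ?(ltW s0)//; lra.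
have : 0 <= ab - bb by rewrite -(@pmulr_rge0 _ (r - s)) ?subr_gt0 //; lra.
lra.
Qed.

Lemma resolvent_le N v z q (r : R) : nonexpansive N -> 0 < r ->
    z - N z = r *: (v - z) -> q = N q -> `|v - z| <= `|v - q|.
Proof.
move=> neN r0 zE Nq.
have := monotone_disp z q neN; rewrite zE -Nq subrr subr0.
have <- : (v - q) - (v - z) = z - q.
  by rewrite opprB addrC addrA subrK.
rewrite innerZl pmulr_rge0 // -[`|_| <= _]ler_sqr ?nnegrE //.
move: (v - z) (v - q) => a b {zE}.
have := sqr_ge0 `|b - a|.
rewrite -!inner_norm !innerE (innerC b a); lra.
Qed.

Lemma resolvent_cvg N v (z : nat -> H) : nonexpansive N -> Fix N !=set0 ->
    (forall n, z n - N (z n) = n.+1%:R^-1 *: (v - z n)) ->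
  cvgn z.
Proof.
move=> neN [q Nq] zE.
pose d n := `|v - z n| ^+ 2.
have r0 n : 0 < (n.+1%:R^-1 : R) by rewrite invr_gt0.
have dE n m : (n <= m)%N -> `|z m - z n| ^+ 2 <= d m - d n.
  rewrite leq_eqVlt => /predU1P[->|nm]; first by rewrite !subrr normr0 expr0n.
  apply: (resolvent_dist neN _ (zE n) (zE m)).
  by rewrite r0 /= ltf_pV2 ?posrE // ltr_nat.
have cd : cvgn d.
  apply: nondecreasing_is_cvgn.
    by move=> n m nm; rewrite -subr_ge0 (le_trans _ (dE _ _ nm)) ?sqr_ge0.
  exists (`|v - q| ^+ 2) => _ [n _ <-].
  by rewrite /d ler_sqr ?nnegrE //; exact: (resolvent_le neN (r0 n)).
apply: cauchy_cvg; apply: cauchy_exP => e e0.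
have e20 : 0 < e ^+ 2 / 2 by rewrite divr_gt0 ?exprn_gt0.
have /cvgrPdist_lt /(_ _ e20) [n _ nd] := cd.
exists (z n); exists n => // m /= nm.
rewrite -ball_normE /= -ltr_sqr ?nnegrE ?(ltW e0)// distrC.
apply: le_lt_trans (dE _ _ nm) _.
have := nd _ nm; have := nd _ (leqnn n) => /=.
rewrite !ltr_norml; lra.
Qed.

(** A fixed point [p] satisfying the variational inequality of the projection of
    [v], in a form that is uniform over approximate fixed points in a ball: this
    replaces the demiclosedness of Id - N at 0. *)
Lemma approx_fix_variational N v : nonexpansive N -> Fix N !=set0 ->
  exists p, p = N p /\ forall e M : R, 0 < e -> 0 <= M ->
    exists2 delta, 0 < delta & forall y, `|y - p| <= M ->
      `|y - N y| <= delta -> inner (v - p) (y - p) <= e.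
Proof.
move=> neN FN.
have r0 n : 0 < (n.+1%:R^-1 : R) by rewrite invr_gt0.
have [z zE] := choice (fun n => resolvent_exists v neN (r0 n)).
have cz := resolvent_cvg neN FN zE.
set p := limn z in cz.
have zp (e : R) : 0 < e -> \forall n \near \oo, `|z n - p| <= e.
  by move/cvgrPdist_le : cz => cz /cz; apply: filterS => n; rewrite distrC.
exists p; split.
  have Ncvg : N (z n) @[n --> \oo] --> N p.
    apply/cvgrPdist_le => e /zp; apply: filterS => n.
    by apply: le_trans; rewrite distrC.
  have h0 : (z n - N (z n)) @[n --> \oo] --> (0 : H).
    rewrite (funext zE) -(scale0r (v - p)).
    by apply: cvgZ; [exact: cvg_harmonic|exact: cvgB (cvg_cst _) cz].
  by apply/eqP; rewrite -subr_eq0; apply/eqP/(cvg_unique _ (cvgB cz Ncvg) h0).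
move=> e M e0 M0.
pose L := M + 1 + `|v - p|.
have L0 : 0 < L by rewrite ltr_pwDl // ltr_wpDl.
have eta0 : 0 < Num.min 1 (e / 2 / L) by rewrite lt_min ltr01 !divr_gt0.
have [n _ /(_ n (leqnn n))] := zp _ eta0; rewrite /= le_min => /andP[zp1 zpe].
exists (n.+1%:R^-1 * (e / 2 / (M + 1))).
  by rewrite mulr_gt0 // !divr_gt0 // ltr_wpDl.
move=> y yM yN.
have yz : `|y - z n| <= M + 1.
  by rewrite (le_trans (ler_distD p _ _))// lerD // distrC.
(* Replace p by z_n in both arguments: the error is at most |z_n - p| L. *)
have -> : inner (v - p) (y - p) = inner (v - z n) (y - z n)
    + inner (z n - p) (y - z n) + inner (v - p) (z n - p).
  have -> : y - p = (y - z n) + (z n - p) by rewrite addrA subrK.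
  by rewrite innerDr -innerDl addrA subrK.
have i1 : inner (v - z n) (y - z n) <= e / 2.
  have := monotone_disp (z n) y neN; rewrite zE.
  rewrite -(opprB y) innerDl innerNl !innerNr innerZl opprK addrC subr_ge0 => h.
  rewrite -(ler_pM2l (r0 n)) (le_trans h) // (le_trans (ler_inner _ _)) //.
  rewrite (le_trans (ler_pM _ _ yN yz)) // -[_ * (M + 1)]mulrA divfK //.
  by rewrite gt_eqF // ltr_wpDl.
have i2 : inner (z n - p) (y - z n) + inner (v - p) (z n - p) <= e / 2.
  apply: (@le_trans _ _ (`|z n - p| * L)).
    rewrite /L mulrDr lerD // (le_trans (ler_inner _ _)) ?ler_wpM2l //.
    by rewrite mulrC.
  by rewrite -ler_pdivlMr.
by rewrite -[leLHS]addrA [leRHS]splitr lerD.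
Qed.
End Resolvent.

(** * A real recursive inequality *)

Section Halpern.
Context {R : realType}.

Lemma nneseries_unbounded (u : nat -> R) (M : R) : (forall k, 0 <= u k) ->
    (\sum_(0 <= k <oo) (u k)%:E = +oo)%E ->
  exists n, M < \sum_(0 <= k < n) u k.
Proof.
move=> u0 uoo; apply: contrapT => /forallNP h.
suff : (\sum_(0 <= k <oo) (u k)%:E <= M%:E)%E by rewrite uoo leye_eq.
apply: lime_le; first by apply: is_cvg_nneseries => n _ _; rewrite lee_fin.
by apply: nearW => n; rewrite sumEFin lee_fin leNgt; apply/negP/h.
Qed.

(** While a_k > e, the inequality taken with e / 2 makes a decrease by at least
    alpha_k e / 2, so by divergence of the series some late a_k is at most e;
    the inequality keeps all later terms below e. *)
Lemma cvg0_of_weighted_rec (a alpha : nat -> R) :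
    (forall k, 0 <= a k) -> (forall k, 0 < alpha k < 1) ->
    (\sum_(0 <= k <oo) (alpha k)%:E = +oo)%E ->
    (forall e, 0 < e -> \forall k \near \oo,
       a k.+1 <= (1 - alpha k) * a k + alpha k * e) ->
  a @ \oo --> (0 : R).
Proof.
move=> a0 al aloo rec; apply/cvgrPdist_le => e e0.
have e20 : 0 < e / 2 by lra.
have [K _ recK] := rec _ e20.
have [k Kk ake] : exists2 k, (K <= k)%N & a k <= e.
  apply: contrapT => nex.
  have gte k : (K <= k)%N -> e < a k.
    by move=> Kk; rewrite ltNge; apply/negP => ake; apply: nex; exists k.
  have bnd n : (e / 2) * \sum_(K <= k < K + n) alpha k <= a K - a (K + n)%N.
    elim: n => [|n IHn]; first by rewrite addn0 big_geq // mulr0 subrr.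
    rewrite addnS big_nat_recr ?leq_addr //= mulrDr.
    have := recK (K + n)%N (leq_addr _ _) => /=.
    have /andP[al0 _] := al (K + n)%N.
    have : 0 <= alpha (K + n)%N * (a (K + n)%N - e).
      by rewrite mulr_ge0 ?(ltW al0) // subr_ge0 ltW // gte // leq_addr.
    move: IHn; lra.
  have al0 k : 0 <= alpha k by case/andP: (al k) => /ltW.
  have [n] := nneseries_unbounded
    (\sum_(0 <= k < K) alpha k + a K / (e / 2)) al0 aloo.
  apply/negP; rewrite -leNgt.
  apply: (@le_trans _ _ (\sum_(0 <= k < K + n) alpha k)).
    rewrite addnC (big_cat_nat (leq0n n) (leq_addr _ _)) /= lerDl.
    by rewrite sumr_ge0.
  rewrite (big_cat_nat (leq0n K) (leq_addr _ _)) /= lerD2l.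
  rewrite ler_pdivlMr // mulrC (le_trans (bnd n)) //.
  by rewrite gerBl.
exists k => // n /= kn.
rewrite sub0r normrN ger0_norm //.
rewrite -(subnKC kn); elim: (n - k)%N => [|m IHm]; first by rewrite addn0.
rewrite addnS (le_trans (recK _ _)) //=.
  by rewrite (leq_trans Kk) ?leq_addr.
have /andP[al0 al1] := al (k + m)%N.
have : 0 <= (1 - alpha (k + m)%N) * (e - a (k + m)%N).
  by rewrite mulr_ge0 // subr_ge0 // ltW.
have : 0 <= alpha (k + m)%N * e by rewrite mulr_ge0 // ltW.
lra.
Qed.
End Halpern.

(** * Strong convergence of the Halpern iteration *)

Section MainArgument.
Context {R : realType} {H : hilbertType R}.

Lemma metric_proj_eq (C : set H) (v p : H) : C p ->
  (forall q, C q -> inner (v - p) (q - p) <= 0) -> metric_proj C v = p.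
Proof.
move=> Cp vp.
have expand q : C q -> `|v - p| ^+ 2 + `|q - p| ^+ 2 <= `|v - q| ^+ 2.
  move=> /vp; have -> : v - q = (v - p) - (q - p) by rewrite opprB addrA subrK.
  move: (v - p) (q - p) => a b.
  rewrite -!inner_norm !innerE (innerC b a); lra.
apply: xget_unique.
  split=> // q /expand h; rewrite -ler_sqr ?nnegrE //.
  by rewrite (le_trans _ h) // lerDl sqr_ge0.
move=> q [/expand h /(_ _ Cp)]; rewrite -ler_sqr ?nnegrE // => h2.
have : `|q - p| ^+ 2 <= 0 by lra.
by rewrite le_eqVlt ltNge sqr_ge0 orbF sqrf_eq0 normr_eq0 subr_eq0 => /eqP.
Qed.

(** Applied to d = x - p and g = x - N x with p = N p: the hypothesis says that
    N does not increase the distance to p. *)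
Lemma averaged_sqr_le (d g : H) (kappa : R) : `|d - g| <= `|d| -> 0 <= kappa ->
  `|d - kappa *: g| ^+ 2 <= `|d| ^+ 2 - kappa * (1 - kappa) * `|g| ^+ 2.
Proof.
rewrite -ler_sqr ?nnegrE // -!inner_norm !innerE (innerC g d) => h k0.
have : 0 <= kappa * (inner d g *+ 2 - inner g g) by rewrite mulr_ge0 //; lra.
lra.
Qed.

Lemma halpern_step_le (u s : H) (a : R) : 0 <= a <= 1 ->
  `|a *: u + (1 - a) *: s| ^+ 2 <=
    (1 - a) * `|s| ^+ 2 + a * (inner u (a *: u + (1 - a) *: s) *+ 2).
Proof.
move=> /andP[a0 a1]; rewrite -!inner_norm !innerE (innerC s u).
have : 0 <= a ^+ 2 * inner u u by rewrite inner_norm mulr_ge0 ?sqr_ge0.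
have : 0 <= a * (1 - a) * inner s s.
  by rewrite inner_norm !mulr_ge0 ?subr_ge0 ?sqr_ge0.
lra.
Qed.

(** Convergence to any fixed point [p] that satisfies the uniform variational
    inequality of [approx_fix_variational]. *)
Lemma halpern_cvg (N : H -> H) (kappa : R) (alpha : nat -> R) (v p : H)
    (x : nat -> H) : nonexpansive N -> 0 < kappa < 1 ->
    (forall k, 0 < alpha k < 1) -> alpha @ \oo --> (0 : R) ->
    (\sum_(0 <= k <oo) (alpha k)%:E = +oo)%E ->
    p = N p ->
    (forall e M : R, 0 < e -> 0 <= M ->
      exists2 delta, 0 < delta & forall y, `|y - p| <= M ->
        `|y - N y| <= delta -> inner (v - p) (y - p) <= e) ->
    (forall k, x k.+1 =
       alpha k *: v + (1 - alpha k) *: (x k - kappa *: (x k - N (x k)))) ->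
  x @ \oo --> p.
Proof.
move=> neN /andP[k0 k1] al al0 aloo Np vi xE.
pose u := v - p; pose d k := x k - p; pose g k := x k - N (x k).
have dE k : d k.+1 = alpha k *: u + (1 - alpha k) *: (d k - kappa *: g k).
  rewrite /d xE /u [in RHS]addrAC !(scalerBr _ _ p) addrACA -opprD -scalerDl.
  by rewrite [alpha k + _]addrC subrK scale1r.
have dg k : `|d k - g k| <= `|d k|.
  rewrite (_ : d k - g k = N (x k) - N p) //.
  by rewrite /d /g opprB addrC addrA subrK -Np.
have al01 k : 0 <= alpha k <= 1 by case/andP: (al k) => /ltW -> /ltW ->.
have kk0 : 0 < kappa * (1 - kappa) by rewrite mulr_gt0 // subr_gt0.
have sd k : `|d k - kappa *: g k| <= `|d k|.
  rewrite -ler_sqr ?nnegrE // (le_trans (averaged_sqr_le (dg k) (ltW k0))) //.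
  by rewrite gerBl mulr_ge0 ?sqr_ge0 // ltW.
pose M := Num.max `|d 0| `|u|.
have uM : `|u| <= M by rewrite le_max lexx orbT.
have M0 : 0 <= M by rewrite (le_trans _ uM).
have dM k : `|d k| <= M.
  elim: k => [|k IHk]; first by rewrite le_max lexx.
  have /andP[a0 a1] := al01 k.
  rewrite dE (le_trans (ler_normD _ _)) // !normrZ !ger0_norm ?subr_ge0 //.
  have : alpha k * `|u| <= alpha k * M by rewrite ler_wpM2l.
  have : (1 - alpha k) * `|d k - kappa *: g k| <= (1 - alpha k) * M.
    by rewrite ler_wpM2l ?subr_ge0 // (le_trans (sd k)).
  lra.
suff /cvgrPdist_le ak : (fun k => `|d k| ^+ 2) @ \oo --> (0 : R).
  apply/cvgrPdist_le => e e0.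
  have := ak _ (exprn_gt0 2 e0); apply: filterS => k.
  rewrite sub0r normrN ger0_norm ?sqr_ge0 // distrC => h.
  by rewrite -ler_sqr ?nnegrE // ltW.
apply: (cvg0_of_weighted_rec _ al aloo) => [k|e e0].
  by rewrite /= sqr_ge0.
have e60 : 0 < e / 6 by lra.
have [delta0 delta00 vid] := vi _ _ e60 M0.
(* delta is the threshold for |g_k|; below it, the three contributions to
   2 <u, d_{k+1}>, from alpha_k |u|^2, <u, d_k> and - kappa <u, g_k>, are at
   most e / 3 each. *)
pose delta := Num.min delta0 (e / 6 / (M + 1)).
have M10 : 0 < M + 1 by rewrite ltr_wpDl.
have delta_gt0 : 0 < delta by rewrite lt_min delta00 divr_gt0.
pose c := kappa * (1 - kappa) * delta ^+ 2.
have c0 : 0 < c by rewrite mulr_gt0 // exprn_gt0.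
(* alpha_k <= eta ensures alpha_k |u|^2 <= e / 6 in the first case, and
   2 alpha_k <u, d_{k+1}> <= c / 2 <= (1 - alpha_k) c in the second. *)
pose eta := Num.min (1 / 2)
  (Num.min (e / 6 / (M ^+ 2 + 1)) (c / 4 / (M ^+ 2 + 1))).
have M21 : 0 < M ^+ 2 + 1 by rewrite ltr_wpDl ?sqr_ge0.
have eta0 : 0 < eta by rewrite !lt_min !divr_gt0.
move/cvgrPdist_le : al0 => /(_ _ eta0); apply: filterS => k.
have /andP[a0 a1] := al01 k.
rewrite sub0r normrN ger0_norm // !le_min => /and3P[a2 ae ac].
rewrite ler_pdivlMr // in ae; rewrite ler_pdivlMr // in ac.
rewrite dE (le_trans (halpern_step_le _ _ (al01 k))) // -dE.
have sE := averaged_sqr_le (dg k) (ltW k0).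
have [gd|gd] := leP `|g k| delta.
- apply: lerD.
    rewrite ler_wpM2l ?subr_ge0 // (le_trans sE) // gerBl.
    by rewrite mulr_ge0 ?sqr_ge0 // ltW.
  rewrite ler_wpM2l //.
  have ud : inner u (d k) <= e / 6.
    by apply: vid; rewrite ?dM // (le_trans gd) // ge_min lexx.
  have ug : - inner u (g k) <= e / 6.
    rewrite -innerNr (le_trans (ler_inner _ _)) // normrN.
    have gM : `|g k| <= e / 6 / (M + 1).
      by rewrite (le_trans gd) // ge_min lexx orbT.
    rewrite (le_trans (ler_pM _ _ uM gM)) // [leLHS]mulrC [leLHS]mulrAC.
    by rewrite ler_pdivrMr // ler_wpM2l ?(ltW e60) // lerDl.
  have uu : alpha k * inner u u <= e / 6.
    rewrite inner_norm (le_trans _ ae) // ler_wpM2l //.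
    by rewrite (@le_trans _ _ (M ^+ 2)) ?lerDl // ler_sqr ?nnegrE.
  have : (1 - alpha k) * inner u (d k) <= (1 - alpha k) * (e / 6).
    by rewrite ler_wpM2l ?subr_ge0.
  have : (1 - alpha k) * (kappa * - inner u (g k)) <= (1 - alpha k) * (e / 6).
    rewrite ler_wpM2l ?subr_ge0 // (le_trans (ler_wpM2l (ltW k0) ug)) //.
    by rewrite ger_pMl // ltW.
  have : (1 - alpha k) * (e / 6) <= e / 6 by rewrite ger_pMl // gerBl.
  have -> : inner u (d k.+1) = alpha k * inner u u +
      (1 - alpha k) * (inner u (d k) + kappa * - inner u (g k)).
    by rewrite dE; move: {+}u (d k) (g k) => u' d' g'; rewrite !innerE mulrN.
  lra.
- have i1 : inner u (d k.+1) <= M ^+ 2.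
    by rewrite (le_trans (ler_inner _ _)) // expr2 ler_pM.
  have g2 : c <= kappa * (1 - kappa) * `|g k| ^+ 2.
    by rewrite ler_wpM2l ?ltW // ltr_sqr ?nnegrE // ltW.
  have : (1 - alpha k) * `|d k - kappa *: g k| ^+ 2 <=
      (1 - alpha k) * (`|d k| ^+ 2 - c).
    by rewrite ler_wpM2l ?subr_ge0 // (le_trans sE) // lerD2l lerN2.
  have : 0 <= (1 / 2 - alpha k) * c by rewrite mulr_ge0 ?subr_ge0 // ltW.
  have : alpha k * inner u (d k.+1) <= alpha k * M ^+ 2 by rewrite ler_wpM2l.
  have : 0 <= alpha k * e by rewrite mulr_ge0 // ltW.
  move: a0 ac; lra.
Qed.
End MainArgument.

Theorem theorem4p8 (R : realType) (H : hilbertType R) (theta : R) (T : H -> H)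
    (lambda : R) (alpha : nat -> R) (x0 v : H) (x : nat -> H)
    (theta_bnd : 0 < theta <= 1)
    (T_averaged : averaged theta T)
    (FixT_neq0 : Fix T !=set0)
    (lambda_bnd : 0 < lambda < 1 / theta)
    (alpha_bnd : forall k, 0 < alpha k < 1)
    (alpha_cvg0 : alpha @ \oo --> (0 : R))
    (alpha_sum : (\sum_(0 <= k <oo) (alpha k)%:E = +oo)%E)
    (x_init : x 0%N = x0)
    (x_rec : forall k, x k.+1 =
       alpha k *: v
       + (1 - alpha k) *: ((1 - lambda) *: x k + lambda *: T (x k))) :
  x @ \oo --> metric_proj (Fix T) v.
Proof.
have [N neN TE] := T_averaged.
have /andP[t0 t1] := theta_bnd; have /andP[l0 l1] := lambda_bnd.
have TsubE y : T y = y - theta *: (y - N y).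
  by rewrite TE scalerBl scale1r scalerBr opprB addrA addrAC.
have FixE : Fix T = Fix N.
  apply/seteqP; split => y; rewrite /Fix /= TsubE => yE.
    have /eqP : theta *: (y - N y) = 0.
      by rewrite -[LHS](subKr y) -yE subrr.
    by rewrite scaler_eq0 gt_eqF //= subr_eq0 => /eqP.
  by rewrite -yE subrr scaler0 subr0.
rewrite FixE in FixT_neq0 *.
have [p [Np vi]] := approx_fix_variational v neN FixT_neq0.
have -> : metric_proj (Fix N) v = p.
  apply: metric_proj_eq => // q Nq.
  apply/ler_addgt0Pr => e e0; rewrite add0r.
  have [delta delta0] := vi _ _ e0 (normr_ge0 (q - p)).
  by apply=> //; rewrite -Nq subrr normr0 ltW.
have k01 : 0 < lambda * theta < 1 by rewrite mulr_gt0 //= -ltr_pdivlMr.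
apply: (halpern_cvg neN k01 alpha_bnd alpha_cvg0 alpha_sum Np vi) => k.
rewrite x_rec TsubE scalerBr addrA -scalerDl subrK scale1r.
by rewrite scalerA.
Qed.
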